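(* Let $(M,g,F)$ be a para-Kähler manifold and let $\mathcal{P}k=\mathcal{P}k(M)$ be the set of para-Kähler structures on $M$. Define the map $$\mathcal{A}:\operatorname{Diff}(M)\times\mathcal{P}k\longrightarrow\mathcal{P}k,\qquad (\psi,(g,F))\longmapsto\bigl((\psi^* )^{-1}g,\;F^\psi\bigr),\qquad F^\psi:=\psi_*\circ F\circ\psi_*^{-1}.$$ Then $\mathcal{A}$ is a left action of the group $\operatorname{Diff}(M)$ on $\mathcal{P}k$ (in particular it is well defined, i.e. takes values in $\mathcal{P}k$). Moreover, for every $\psi\in\operatorname{Diff}(M)$ and every $(g,F)\in\mathcal{P}k$, the Levi-Civita connection $\nabla^{(\psi^* )^{-1}g}$ of $(\psi^* )^{-1}g$ is the push-forward $(\nabla^g)^\psi$ of the Levi-Civita connection $\nabla^g$ of $g$. As a consequence, the restriction of $\mathcal{A}$ to affine para-Kähler structures is well defined; that is, if $(g,F)$ is affine then $\mathcal{A}(\psi,(g,F))$ is affine for every $\psi\in\operatorname{Diff}(M)$.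
   Context: All objects are smooth and $M$ is a smooth manifold of dimension $2n$, $n>0$. An almost paracomplex structure on $M$ is a tensor field $F\in\Gamma(\operatorname{End}(TM))$ with $F^2=\operatorname{Id}$ such that the eigenbundles $F^+=\ker(F-\operatorname{Id})$ and $F^-=\ker(F+\operatorname{Id})$ both have rank $n$. If $g$ is a pseudo-Riemannian metric of neutral signature $(n,n)$ on $M$, then $F$ is $g$-compatible if $g(FX,FY)=-g(X,Y)$ for all vector fields $X,Y\in\mathfrak{X}(M)$. $\nabla^g$ denotes the Levi-Civita connection of $g$. A para-Kähler structure on $M$ is a pair $(g,F)$ where $g$ is a neutral metric, $F$ is a $g$-compatible almost paracomplex structure, and $\nabla^gF=0$; then $(M,g,F)$ is called a para-Kähler manifold. The set of all para-Kähler structures on $M$ is $\mathcal{P}k(M)$. A para-Kähler structure $(g,F)$ is affine if $\nabla^g$ is flat (has zero curvature). For a diffeomorphism $\psi$ of $M$, $\psi_*$ denotes the push-forward of vector fields, $(\psi^* )^{-1}g=(\psi^{-1})^*g$, and $F^\psi$ is defined by viewing $F$ as a $C^\infty(M)$-linear map $\mathfrak{X}(M)\to\mathfrak{X}(M)$. For a linear connection $\nabla$ on $M$, its push-forward $\nabla^\psi$ is the linear connection $$(\nabla^\psi)_XY=\psi_*\bigl(\nabla_{\psi_*^{-1}X}\,\psi_*^{-1}Y\bigr),\qquad X,Y\in\mathfrak{X}(M).$$ *)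

(* Defs.v *)
From HB Require Import structures.
From mathcomp Require Import all_boot all_order all_algebra.
From mathcomp Require Import all_classical all_reals topology normedtype landau derive.
From mathcomp Require Import ring.

Set Implicit Arguments.
Unset Strict Implicit.
Unset Printing Implicit Defensive.

Import Order.TTheory GRing.Theory Num.Theory.
Import numFieldNormedType.Exports.

Local Open Scope classical_set_scope.
Local Open Scope ring_scope.

Section SmoothOn.
Context {R : realType}.

(* [f] is of class C^k on [U], for [U] open.  Frechet differentiability, which
   follows from the continuity of the partial derivatives, is part of the
   definition because ['D_v f] is a total function. *)
Fixpoint class_C (k : nat) {m : nat} (U : set 'rV[R]_m) (f : 'rV[R]_m -> R)
    : Prop :=
  if k is k'.+1 then
    (forall x, U x -> differentiable f x) /\
    (forall i : 'I_m, class_C k' U (fun x => 'D_('e_i) f x))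
  else forall x, U x -> {for x, continuous f}.

Definition smooth_on {m : nat} (U : set 'rV[R]_m) (f : 'rV[R]_m -> R) :=
  forall k, class_C k U f.

Definition smooth_onV {m l : nat} (U : set 'rV[R]_m)
    (h : 'rV[R]_m -> 'rV[R]_l) :=
  forall j : 'I_l, smooth_on U (fun x => h x 0 j).

Lemma class_C_sub k m (U V : set 'rV[R]_m) f :
  V `<=` U -> class_C k U f -> class_C k V f.
Proof.
move=> VU; elim: k f => [|k IH] f /=; first by move=> h x /VU; exact: h.
by move=> [h1 h2]; split=> [x /VU|i]; [exact: h1 | exact/IH/h2].
Qed.

Lemma near_eq_differentiable (V W : normedModType R) (f g : V -> W) (x : V) :
  (\near x, f x = g x) -> differentiable f x -> differentiable g x.
Proof.
move=> fg /diff_locallyP [cdf dfE].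
have gx : g x = f x by rewrite (nbhs_singleton fg).
have fg0 : \forall h \near (0 : V), f (h + x) = g (h + x).
  by move: fg; rewrite (near_shift 0 x); apply: filterS => h /=; rewrite subr0.
have dgE : g \o shift x = cst (g x) + 'd f x +o_ 0 id.
  have /eqaddoP dfo := dfE.
  apply/eqaddoP => e e0; have dfe := dfo e e0.
  apply: (@filterS2 _ (nbhs (0 : V)) _ _ _ _ _ fg0 dfe) => h fgh.
  by congr (`|_| <= _); rewrite !fctE /= gx fgh.
have dE := diff_unique cdf dgE.
by apply/diff_locallyP; rewrite dE.
Qed.

Lemma class_C_ext k m (U : set 'rV[R]_m) f g : open U ->
  (forall x, U x -> f x = g x) -> class_C k U f -> class_C k U g.
Proof.
move=> oU; elim: k f g => [|k IH] f g fg.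
  move=> h x Ux.
  have nfg : \near x, f x = g x.
    exact: filterS fg (open_nbhs_nbhs (conj oU Ux)).
  move: (h x Ux); rewrite /prop_for /continuous_at -(fg x Ux).
  by apply: cvg_trans; exact: near_eq_cvg nfg.
have nfg x : U x -> \near x, f x = g x.
  by move=> Ux; exact: filterS fg (open_nbhs_nbhs (conj oU Ux)).
move=> [h1 h2]; split=> [x Ux|i].
  exact: near_eq_differentiable (nfg _ Ux) (h1 _ Ux).
by apply: IH (h2 i) => x Ux; exact/near_eq_derive/nfg.
Qed.

Lemma class_C_pred k m (U : set 'rV[R]_m) f : class_C k.+1 U f -> class_C k U f.
Proof.
elim: k f => [|k IH] f [h1 h2].
  by move=> x Ux; exact: differentiable_continuous (h1 x Ux).
by split=> // i; exact: IH (h2 i).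
Qed.

Lemma class_C_cst k m (U : set 'rV[R]_m) (c : R) : class_C k U (cst c).
Proof.
elim: k c => [|k IH] c; first by move=> x _; exact: cst_continuous.
split=> [x _|i]; first exact: differentiable_cst.
by rewrite [X in class_C _ _ X](_ : _ = cst 0) //; apply/funext => x; rewrite derive_cst.
Qed.

Lemma class_C_add k m (U : set 'rV[R]_m) f g : open U ->
  class_C k U f -> class_C k U g -> class_C k U (f \+ g).
Proof.
move=> oU; elim: k f g => [|k IH] f g.
  by move=> hf hg x Ux; exact: cvgD (hf x Ux) (hg x Ux).
move=> [f1 f2] [g1 g2]; split=> [x Ux|i].
  exact: differentiableD (f1 x Ux) (g1 x Ux).
apply: class_C_ext oU _ (IH _ _ (f2 i) (g2 i)) => x Ux /=.
by rewrite (deriveD (diff_derivable (f1 x Ux)) (diff_derivable (g1 x Ux))).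
Qed.

Lemma class_C_mul k m (U : set 'rV[R]_m) f g : open U ->
  class_C k U f -> class_C k U g -> class_C k U (f \* g).
Proof.
move=> oU; elim: k f g => [|k IH] f g.
  by move=> hf hg x Ux; exact: cvgM (hf x Ux) (hg x Ux).
move=> hf hg; have [f0 g0] := (class_C_pred hf, class_C_pred hg).
case: hf hg => [f1 f2] [g1 g2]; split=> [x Ux|i].
  exact: differentiableM (f1 x Ux) (g1 x Ux).
apply: class_C_ext oU _
  (class_C_add oU (IH _ _ f0 (g2 i)) (IH _ _ g0 (f2 i))) => x Ux /=.
by rewrite (deriveM (diff_derivable (f1 x Ux)) (diff_derivable (g1 x Ux))).
Qed.

Lemma class_C_sum k m (U : set 'rV[R]_m) (I : finType) (F : I -> 'rV[R]_m -> R) :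
  open U -> (forall i, class_C k U (F i)) ->
  class_C k U (fun x => \sum_i F i x).
Proof.
move=> oU h; rewrite (_ : (fun x => _) = \sum_i F i); last first.
  by rewrite fct_sumE.
by apply: big_ind => //; [exact: class_C_cst | move=> *; exact: class_C_add].
Qed.

Lemma row_sum_e m (v : 'rV[R]_m) : v = \sum_j v 0 j *: 'e_j.
Proof. exact: row_sum_delta. Qed.

Lemma differentiableV m l (h : 'rV[R]_m -> 'rV[R]_l) x :
  (forall j, differentiable (fun x => h x 0 j) x) -> differentiable h x.
Proof.
move=> dh; rewrite (_ : h = \sum_j (fun x => h x 0 j *: 'e_j)); last first.
  by apply/funext => y; rewrite fct_sumE -row_sum_e.
by apply: differentiable_sum => j; exact: differentiableZl.
Qed.

Lemma derive_coord m l (h : 'rV[R]_m -> 'rV[R]_l) x v j :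
  differentiable h x -> 'D_v (fun x => h x 0 j) x = ('D_v h x) 0 j.
Proof.
by move=> dh; rewrite derive_mx ?mxE //; exact: diff_derivable.
Qed.

Lemma class_C_comp k m l (U : set 'rV[R]_m) (V : set 'rV[R]_l)
    (h : 'rV[R]_m -> 'rV[R]_l) (f : 'rV[R]_l -> R) :
  open U -> (forall x, U x -> V (h x)) -> smooth_onV U h ->
  class_C k V f -> class_C k U (f \o h).
Proof.
move=> oU UV sh.
have dh x : U x -> differentiable h x.
  by move=> Ux; apply: differentiableV => j; have [+ _] := sh j 1; exact.
elim: k f => [|k IH] f.
  move=> cf x Ux; apply: continuous_comp; last exact/cf/UV.
  exact: differentiable_continuous (dh x Ux).
move=> [f1 f2]; split=> [x Ux|i].
  exact: differentiable_comp (dh x Ux) (f1 _ (UV _ Ux)).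
have H : class_C k U (fun x => \sum_j 'D_('e_i) (fun x => h x 0 j) x
                                 * ('D_('e_j) f \o h) x).
  apply: class_C_sum => // j; apply: class_C_mul => //; last exact: IH (f2 j).
  by have [_ +] := sh j k.+1; exact.
apply: class_C_ext oU _ H => x Ux.
have [dhx dfx] := (dh x Ux, f1 _ (UV _ Ux)).
rewrite (deriveE _ (differentiable_comp dhx dfx)) diff_comp //=.
rewrite -(deriveE _ dhx).
rewrite {1}[X in diff _ _ X]row_sum_e linear_sum /=; apply: eq_bigr => j _.
by rewrite linearZ /= -deriveE // derive_coord.
Qed.

Lemma smooth_onV_comp m l p (U : set 'rV[R]_m) (V : set 'rV[R]_l)
    (h : 'rV[R]_m -> 'rV[R]_l) (f : 'rV[R]_l -> 'rV[R]_p) :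
  open U -> (forall x, U x -> V (h x)) -> smooth_onV U h ->
  smooth_onV V f -> smooth_onV U (f \o h).
Proof.
move=> oU UV sh sf j k.
exact: (class_C_comp (f := fun x => f x 0 j)) oU UV sh (sf j k).
Qed.

Lemma class_C_loc k m (U : set 'rV[R]_m) f :
  (forall x, U x -> exists2 V, V x & class_C k V f) -> class_C k U f.
Proof.
elim: k f => [|k IH] f h.
  by move=> x /h [V Vx hV]; exact: hV.
split=> [x /h [V Vx [hV _]]|i]; first exact: hV.
by apply: IH => x /h [V Vx [_ hV]]; exists V; last exact: hV.
Qed.

End SmoothOn.

(* [cmap] and [cinv] are total functions, meaningful only on [cdom] and on
   [cmap @` cdom] respectively. *)
Record chart (R : realType) (m : nat) (T : topologicalType) := Chart {
  cdom : set T;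
  cmap : T -> 'rV[R]_m;
  cinv : 'rV[R]_m -> T;
  cdom_open : open cdom;
  cimg_open : open (cmap @` cdom);
  cmapK : {in cdom, cancel cmap cinv};
  cmap_continuous : forall p, cdom p -> {for p, continuous cmap};
  cinv_continuous : forall x, (cmap @` cdom) x -> {for x, continuous cinv} }.

Arguments cdom_open {R m T} c.
Arguments cimg_open {R m T} c.

(* The smooth structure is given by any (not necessarily maximal) atlas. *)
Record manifold (R : realType) (m : nat) := Manifold {
  mtype :> topologicalType;
  mhausdorff : hausdorff_space mtype;
  msecond_countable : @second_countable mtype;
  atlas : set (chart R m mtype);
  atlas_cover : forall p : mtype, exists2 c, atlas c & cdom c p;
  atlas_compat : forall c d, atlas c -> atlas d ->
    smooth_onV (cmap c @` (cdom c `&` cdom d)) (cmap d \o cinv c) }.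

Section SmoothFunctions.
Context {R : realType} {m : nat}.
Implicit Types M N : manifold R m.

Definition smooth_fun M (f : M -> R) :=
  forall c, atlas c -> smooth_on (cmap c @` cdom c) (f \o cinv c).

Definition smooth_map M N (psi : M -> N) :=
  continuous psi /\
  forall c d, atlas c -> atlas d ->
    smooth_onV (cmap c @` (cdom c `&` psi @^-1` cdom d))
               (cmap d \o psi \o cinv c).

Lemma cmap_img_open M (c : chart R m M) (A : set M) :
  open A -> open (cmap c @` (cdom c `&` A)).
Proof.
move=> oA; rewrite openE => _ [p [cp Ap] <-]; rewrite /interior /=.
have xU : (cmap c @` cdom c) (cmap c p) by exists p.
have nA : nbhs (cmap c p) (cinv c @^-1` A).
  apply: (cinv_continuous xU); rewrite cmapK ?inE //.
  exact: open_nbhs_nbhs.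
have nU := open_nbhs_nbhs (conj (cimg_open c) xU).
apply: filterS (filterI nA nU).
move=> x [/= Ax [q cq qx]]; move: Ax; rewrite -qx cmapK ?inE // => Aq.
by exists q.
Qed.

Lemma smooth_fun_cst M (a : R) : smooth_fun (cst a : M -> R).
Proof. by move=> c _ k; exact: class_C_cst. Qed.

Lemma smooth_fun_add M (f g : M -> R) :
  smooth_fun f -> smooth_fun g -> smooth_fun (f \+ g).
Proof.
move=> sf sg c ac k.
exact: class_C_add (cimg_open c) (sf c ac k) (sg c ac k).
Qed.

Lemma smooth_fun_mul M (f g : M -> R) :
  smooth_fun f -> smooth_fun g -> smooth_fun (f \* g).
Proof.
move=> sf sg c ac k.
exact: class_C_mul (cimg_open c) (sf c ac k) (sg c ac k).
Qed.

Lemma smooth_fun_comp M N (psi : M -> N) (f : N -> R) :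
  smooth_map psi -> smooth_fun f -> smooth_fun (f \o psi).
Proof.
move=> [cpsi spsi] sf c ac k; apply: class_C_loc => _ [p cp <-].
have [d ad dp] := atlas_cover (psi p).
pose A := psi @^-1` cdom d.
have oA : open A by apply: open_comp (cdom_open d) => x _; exact: cpsi.
have oU : open (cmap c @` (cdom c `&` A)) by exact: cmap_img_open.
exists (cmap c @` (cdom c `&` A)); first by exists p.
have UV x : (cmap c @` (cdom c `&` A)) x ->
    (cmap d @` cdom d) ((cmap d \o psi \o cinv c) x).
  by move=> [q [cq Aq] <-] /=; rewrite cmapK ?inE //; exists (psi q).
have := class_C_comp oU UV (spsi c d ac ad) (sf d ad k).
apply: class_C_ext => // _ [q [cq Aq] <-] /=.
by rewrite !cmapK ?inE.
Qed.

Lemma smooth_map_id M : smooth_map (@id M).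
Proof. by split=> [x //|c d ac ad]; exact: atlas_compat ac ad. Qed.

Lemma smooth_map_comp M N (P : manifold R m) (phi : N -> P) (psi : M -> N) :
  smooth_map phi -> smooth_map psi -> smooth_map (phi \o psi).
Proof.
move=> [cphi sphi] [cpsi spsi]; split.
  by move=> x; apply: continuous_comp; [exact: cpsi | exact: cphi].
move=> c e ac ae j k; apply: class_C_loc => _ [p [cp ep] <-].
have [d ad dp] := atlas_cover (psi p).
pose B := cdom d `&` phi @^-1` cdom e.
have oB : open B.
  apply: openI; first exact: cdom_open.
  by apply: open_comp (cdom_open e) => x _; exact: cphi.
pose A := psi @^-1` B.
have oA : open A by apply: open_comp oB => x _; exact: cpsi.
have oU : open (cmap c @` (cdom c `&` A)) by exact: cmap_img_open.
exists (cmap c @` (cdom c `&` A)); first by exists p.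
have UV x : (cmap c @` (cdom c `&` A)) x ->
    (cmap d @` B) ((cmap d \o psi \o cinv c) x).
  by move=> [q [cq Aq] <-] /=; rewrite cmapK ?inE //; exists (psi q).
have s1 : smooth_onV (cmap c @` (cdom c `&` A)) (cmap d \o psi \o cinv c).
  move=> i l; apply: class_C_sub (spsi c d ac ad i l).
  by move=> _ [q [cq [dq _]] <-]; exists q.
have := class_C_comp oU UV s1 (sphi d e ad ae j k).
apply: class_C_ext => // _ [q [cq [dq eq]] <-] /=.
by rewrite !cmapK ?inE.
Qed.

End SmoothFunctions.

Section Cinf.
Context {R : realType} {m : nat} (M : manifold R m).

Definition smooth_pred : {pred M -> R^o} := fun f => `[< smooth_fun f >].

Let smooth_fun_opp (f : M -> R) : smooth_fun f -> smooth_fun (- f).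
Proof.
move=> sf; rewrite (_ : - f = (cst (-1) : M -> R) \* f); last first.
  by apply/funext => x /=; rewrite mulN1r.
exact: smooth_fun_mul (smooth_fun_cst _) sf.
Qed.

Lemma smooth_subring : subring_closed smooth_pred.
Proof.
split; first by apply/asboolP; exact: smooth_fun_cst.
  move=> f g /asboolP sf /asboolP sg; apply/asboolP.
  exact: smooth_fun_add sf (smooth_fun_opp sg).
move=> f g /asboolP sf /asboolP sg; apply/asboolP; exact: smooth_fun_mul.
Qed.

Lemma smooth_submod : submod_closed smooth_pred.
Proof.
split; first by apply/asboolP; exact: smooth_fun_cst.
move=> a f g /asboolP sf /asboolP sg; apply/asboolP.
exact: smooth_fun_add (smooth_fun_mul (smooth_fun_cst a) sf) sg.
Qed.

HB.instance Definition _ :=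
  GRing.isSubringClosed.Build _ smooth_pred smooth_subring.
HB.instance Definition _ :=
  GRing.isSubmodClosed.Build _ _ smooth_pred smooth_submod.

Record Cinf := MkCinf { cfun :> M -> R^o; _ : cfun \in smooth_pred }.
HB.instance Definition _ := [isSub for cfun].
HB.instance Definition _ := [Choice of Cinf by <:].
HB.instance Definition _ :=
  GRing.SubChoice_isSubComPzRing.Build _ _ Cinf (subringClosedP smooth_pred).
HB.instance Definition _ := [SubZmodule_isSubLmodule of Cinf by <:].

Lemma Cinf_smooth (f : Cinf) : smooth_fun f.
Proof. by case: f => f /= /asboolP. Qed.

Definition mkCinf (f : M -> R) (sf : smooth_fun f) : Cinf := MkCinf (asboolT sf).

(* The tangent space at [p] is the space of derivations at [p] of the algebra
   [Cinf] of globally defined smooth functions. *)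
Definition derivation_at (p : M) (D : Cinf -> R^o) :=
  linear D /\ forall f g : Cinf, D (f * g) = D f * g p + f p * D g.

Definition tangent_pred (p : M) : {pred Cinf -> R^o} :=
  fun D => `[< derivation_at p D >].

Lemma tangent_submod p : submod_closed (tangent_pred p).
Proof.
split.
  apply/asboolP; split=> [a f g|f g]; rewrite /= ?scaler0 ?addr0 //.
  by rewrite mul0r mulr0 addr0.
move=> a D E /asboolP [Dl DL] /asboolP [El EL]; apply/asboolP; split.
  move=> b f g; rewrite !fctE Dl El !scalerDr addrACA.
  by congr (_ + _); rewrite !scalerA mulrC.
move=> f g; rewrite !fctE DL EL /GRing.scale /=.
by rewrite !mulrDr !mulrDl !mulrA [f p * a]mulrC addrACA.
Qed.

HB.instance Definition _ p :=
  GRing.isSubmodClosed.Build _ _ (tangent_pred p) (tangent_submod p).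

Record tangent (p : M) :=
  MkTangent { tfun :> Cinf -> R^o; _ : tfun \in tangent_pred p }.
HB.instance Definition _ p := [isSub for @tfun p].
HB.instance Definition _ p := [Choice of tangent p by <:].
HB.instance Definition _ p := [SubChoice_isSubLmodule of tangent p by <:].

Lemma tangentP p (v : tangent p) : derivation_at p v.
Proof. by case: v => v /= /asboolP. Qed.

Definition mkTangent p D (dD : derivation_at p D) : tangent p :=
  MkTangent (asboolT dD).

Lemma tangent_ext p (v w : tangent p) : (forall f, v f = w f) -> v = w.
Proof. by move=> vw; apply/val_inj/funext. Qed.

End Cinf.

Section VectorFields.
Context {R : realType} {m : nat} (M : manifold R m).
Local Notation C := (Cinf M).

Record vfield := MkVfield {
  vfun :> forall p : M, tangent p;
  vfield_smooth : forall f : C, smooth_fun (fun p => vfun p f) }.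

HB.instance Definition _ := gen_eqMixin vfield.
HB.instance Definition _ := gen_choiceMixin vfield.

Lemma vfield_ext (X Y : vfield) : (forall p f, X p f = Y p f) -> X = Y.
Proof.
case: X Y => [X sX] [Y sY] /= XY.
have E : X = Y by apply: functional_extensionality_dep => p; exact: tangent_ext.
by subst Y; congr MkVfield; exact: Prop_irrelevance.
Qed.

(* The derivative [X . f]. *)
Definition vact (X : vfield) (f : C) : C := mkCinf (vfield_smooth X f).

Fact vzero_smooth (f : C) : smooth_fun (fun p : M => (0 : tangent p) f).
Proof. exact: smooth_fun_cst. Qed.
Definition vzero := MkVfield vzero_smooth.

Fact vadd_smooth (X Y : vfield) (f : C) : smooth_fun (fun p => (X p + Y p) f).
Proof. exact: smooth_fun_add (vfield_smooth X f) (vfield_smooth Y f). Qed.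
Definition vadd X Y := MkVfield (vadd_smooth X Y).

Fact vopp_smooth (X : vfield) (f : C) : smooth_fun (fun p => (- X p) f).
Proof. exact: Cinf_smooth (- vact X f). Qed.
Definition vopp X := MkVfield (vopp_smooth X).

Fact vscale_smooth (h : C) (X : vfield) (f : C) :
  smooth_fun (fun p => (h p *: X p) f).
Proof. exact: smooth_fun_mul (Cinf_smooth h) (vfield_smooth X f). Qed.
Definition vscale h X := MkVfield (vscale_smooth h X).

Fact vaddA : associative vadd.
Proof. by move=> X Y Z; apply: vfield_ext => p f; rewrite /= addrA. Qed.
Fact vaddC : commutative vadd.
Proof. by move=> X Y; apply: vfield_ext => p f; rewrite /= addrC. Qed.
Fact vadd0 : left_id vzero vadd.
Proof. by move=> X; apply: vfield_ext => p f; rewrite /= add0r. Qed.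
Fact vaddN : left_inverse vzero vopp vadd.
Proof. by move=> X; apply: vfield_ext => p f; rewrite /= addNr. Qed.
HB.instance Definition _ :=
  GRing.isZmodule.Build vfield vaddA vaddC vadd0 vaddN.

Fact vscaleA h k (X : vfield) : vscale h (vscale k X) = vscale (h * k) X.
Proof. by apply: vfield_ext => p f; rewrite /= scalerA. Qed.
Fact vscale1 : left_id 1 vscale.
Proof. by move=> X; apply: vfield_ext => p f; rewrite /= scale1r. Qed.
Fact vscaleDr : right_distributive vscale +%R.
Proof. by move=> h X Y; apply: vfield_ext => p f; rewrite /= scalerDr. Qed.
Fact vscaleDl (X : vfield) : {morph vscale^~ X : h k / h + k}.
Proof. by move=> h k; apply: vfield_ext => p f; rewrite /= scalerDl. Qed.
HB.instance Definition _ := GRing.Zmodule_isLmodule.Build C vfield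
  vscaleA vscale1 vscaleDr vscaleDl.

(* The bracket [X, Y] f = X (Y f) - Y (X f). *)
Fact lie_derivation (X Y : vfield) p :
  derivation_at p (fun f => X p (vact Y f) - Y p (vact X f)).
Proof.
have actl (Z : vfield) (a : R) f g : vact Z (a *: f + g) = a *: vact Z f + vact Z g.
  by apply/val_inj/funext => q /=; have [-> _] := tangentP (Z q).
have actM (Z : vfield) f g : vact Z (f * g) = vact Z f * g + f * vact Z g.
  by apply/val_inj/funext => q /=; have [_ ->] := tangentP (Z q).
have addT (v : tangent p) (f g : C) : v (f + g) = v f + v g.
  by have [vl _] := tangentP v; have := vl 1 f g; rewrite !scale1r.
have [[Xl XL] [Yl YL]] := (tangentP (X p), tangentP (Y p)).
split=> [a f g|f g].
  by rewrite !actl Xl Yl scalerBr opprD addrACA.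
rewrite !actM !addT !XL !YL /=; ring.
Qed.

Fact lie_smooth (X Y : vfield) (f : C) :
  smooth_fun (fun p => mkTangent (lie_derivation X Y p) f).
Proof. exact: Cinf_smooth (vact X (vact Y f) - vact Y (vact X f)). Qed.

Definition lie X Y := MkVfield (lie_smooth X Y).

End VectorFields.

Section Tensors.
Context {R : realType} {m : nat} (M : manifold R m).

(* Sections of End(TM) and of T*M (x) T*M, given fibrewise.  Smoothness is
   tested on smooth vector fields. *)
Record endo_field := MkEndo {
  efun :> forall p : M, tangent p -> tangent p;
  endo_linear : forall p, linear (@efun p);
  endo_smooth : forall (X : vfield M) (f : Cinf M),
    smooth_fun (fun p => efun (X p) f) }.

Record bilin_field := MkBilin {
  bfun :> forall p : M, tangent p -> tangent p -> R^o;
  bilin_linearl : forall p (w : tangent p), linear (fun v => bfun v w);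
  bilin_linearr : forall p (v : tangent p), linear (bfun v);
  bilin_smooth : forall X Y : vfield M,
    smooth_fun (fun p => bfun (X p) (Y p)) }.

Definition eapp (F : endo_field) (X : vfield M) : vfield M :=
  MkVfield (endo_smooth F X).

Definition bapp (g : bilin_field) (X Y : vfield M) : Cinf M :=
  mkCinf (bilin_smooth g X Y).

Definition is_basis (V : lmodType R) (S : set V) (k : nat) (e : 'I_k -> V) :=
  [/\ forall i, S (e i),
      forall a : 'I_k -> R, \sum_i a i *: e i = 0 -> forall i, a i = 0 &
      forall v, S v -> exists a : 'I_k -> R, v = \sum_i a i *: e i].

Definition eigenspace_at (F : endo_field) (a : R) (p : M) : set (tangent p) :=
  [set v | F p v = a *: v].
Arguments eigenspace_at : clear implicits.

Definition almost_paracomplex (n : nat) (F : endo_field) :=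
  (forall p (v : tangent p), F p (F p v) = v) /\
  forall p,
    (exists e : 'I_n -> tangent p, is_basis (eigenspace_at F 1 p) e) /\
    (exists e : 'I_n -> tangent p, is_basis (eigenspace_at F (-1) p) e).

Definition has_signature (g : bilin_field) (r s : nat) (p : M) :=
  exists e : 'I_(r + s) -> tangent p, is_basis [set: tangent p] e /\
    forall i j, g p (e i) (e j) =
      if i == j then (if (i < r)%N then 1 else -1) else 0.

Definition neutral_metric (n : nat) (g : bilin_field) :=
  (forall p (v w : tangent p), g p v w = g p w v) /\
  forall p, has_signature g n n p.

Definition compatible (g : bilin_field) (F : endo_field) :=
  forall X Y, bapp g (eapp F X) (eapp F Y) = - bapp g X Y.

Definition operator := vfield M -> vfield M -> vfield M.

(* Additivity in the second argument and the Leibniz rule applied to constant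
   functions give linearity over the reals. *)
Definition linear_connection (nabla : operator) :=
  [/\ forall (f : Cinf M) X X' Y,
        nabla (f *: X + X') Y = f *: nabla X Y + nabla X' Y,
      forall X Y Y', nabla X (Y + Y') = nabla X Y + nabla X Y' &
      forall (f : Cinf M) X Y, nabla X (f *: Y) = vact X f *: Y + f *: nabla X Y].

Definition torsion (nabla : operator) X Y := nabla X Y - nabla Y X - lie X Y.

Definition curvature (nabla : operator) X Y Z :=
  nabla X (nabla Y Z) - nabla Y (nabla X Z) - nabla (lie X Y) Z.

Definition flat nabla := forall X Y Z, curvature nabla X Y Z = 0.

(* (nabla_X F) Y *)
Definition nabla_endo (nabla : operator) (F : endo_field) X Y :=
  nabla X (eapp F Y) - eapp F (nabla X Y).

Definition metric_connection (g : bilin_field) (nabla : operator) :=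
  forall X Y Z,
    vact X (bapp g Y Z) = bapp g (nabla X Y) Z + bapp g Y (nabla X Z).

Definition is_levi_civita (g : bilin_field) (nabla : operator) :=
  [/\ linear_connection nabla, forall X Y, torsion nabla X Y = 0 &
      metric_connection g nabla].

(* By the fundamental theorem of pseudo-Riemannian geometry exactly one
   operator satisfies [is_levi_civita g] when [g] is a pseudo-Riemannian metric,
   so that the default value is then irrelevant. *)
Definition levi_civita (g : bilin_field) : operator :=
  xget (fun _ _ => 0) (is_levi_civita g).

Definition para_kahler (n : nat) : set (bilin_field * endo_field) :=
  [set gF | [/\ neutral_metric n gF.1, almost_paracomplex n gF.2,
      compatible gF.1 gF.2 &
      forall X Y, nabla_endo (levi_civita gF.1) gF.2 X Y = 0]].

Definition affine_para_kahler (n : nat) : set (bilin_field * endo_field) :=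
  [set gF | para_kahler n gF /\ flat (levi_civita gF.1)].

End Tensors.

Section Diffeo.
Context {R : realType} {m : nat} (M : manifold R m).

Record diffeo := MkDiffeo {
  dmap :> M -> M;
  dinv : M -> M;
  dmapK : cancel dmap dinv;
  dinvK : cancel dinv dmap;
  dmap_smooth : smooth_map dmap;
  dinv_smooth : smooth_map dinv }.

HB.instance Definition _ := gen_eqMixin diffeo.
HB.instance Definition _ := gen_choiceMixin diffeo.

Lemma diffeo_ext (phi psi : diffeo) : (forall p, phi p = psi p) -> phi = psi.
Proof.
case: phi psi => [f f' fK f'K sf sf'] [g g' gK g'K sg sg'] /= /funext fg.
subst g; have E : f' = g' by apply/funext => p; rewrite -[LHS]gK f'K.
by subst g'; congr MkDiffeo; exact: Prop_irrelevance.
Qed.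

Definition diffeo_one := MkDiffeo (fun=> erefl) (fun=> erefl)
  (@smooth_map_id R m M) (@smooth_map_id R m M).

Definition diffeo_inv (psi : diffeo) :=
  MkDiffeo (dinvK psi) (dmapK psi) (dinv_smooth psi) (dmap_smooth psi).

Definition diffeo_mul (phi psi : diffeo) :=
  MkDiffeo (can_comp (dmapK phi) (dmapK psi)) (can_comp (dinvK psi) (dinvK phi))
    (smooth_map_comp (dmap_smooth phi) (dmap_smooth psi))
    (smooth_map_comp (dinv_smooth psi) (dinv_smooth phi)).

Fact diffeo_mulA : associative diffeo_mul.
Proof. by move=> x y z; apply: diffeo_ext. Qed.
Fact diffeo_mul1 : left_id diffeo_one diffeo_mul.
Proof. by move=> x; apply: diffeo_ext. Qed.
Fact diffeo_mulr1 : right_id diffeo_one diffeo_mul.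
Proof. by move=> x; apply: diffeo_ext. Qed.
Fact diffeo_mulV : left_inverse diffeo_one diffeo_inv diffeo_mul.
Proof. by move=> x; apply: diffeo_ext => p /=; rewrite dmapK. Qed.
Fact diffeo_mulrV : right_inverse diffeo_one diffeo_inv diffeo_mul.
Proof. by move=> x; apply: diffeo_ext => p /=; rewrite dinvK. Qed.
HB.instance Definition _ := isGroup.Build diffeo
  diffeo_mulA diffeo_mul1 diffeo_mulr1 diffeo_mulV diffeo_mulrV.

Definition pullback (psi : diffeo) (f : Cinf M) : Cinf M :=
  mkCinf (smooth_fun_comp (dmap_smooth psi) (Cinf_smooth f)).

Fact tangent_push_derivation (psi : diffeo) p q (e : psi p = q)
  (v : tangent p) : derivation_at q (fun f => v (pullback psi f)).
Proof.
have [vl vL] := tangentP v; split=> [a f g|f g].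
  by rewrite -vl; congr (v _); exact/val_inj.
rewrite -e -[f (psi p)]/(pullback psi f p) -[g (psi p)]/(pullback psi g p) -vL.
by congr (v _); exact/val_inj.
Qed.

(* The differential of [psi] at [p].  The target point is a parameter, with an
   equation, so as to land in the tangent space at [q] also when [psi p] is only
   propositionally equal to [q]. *)
Definition tangent_push (psi : diffeo) p q (e : psi p = q) (v : tangent p)
  : tangent q := mkTangent (tangent_push_derivation e v).

Lemma tangent_push_linear (psi : diffeo) p q (e : psi p = q) :
  linear (tangent_push e).
Proof. by move=> a v w; apply: tangent_ext => f. Qed.

Fact vpush_smooth (psi : diffeo) (X : vfield M) (f : Cinf M) :
  smooth_fun (fun q => tangent_push (dinvK psi q) (X (dinv psi q)) f).
Proof.
exact: smooth_fun_comp (dinv_smooth psi) (vfield_smooth X (pullback psi f)).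
Qed.

Definition vpush (psi : diffeo) (X : vfield M) : vfield M :=
  MkVfield (vpush_smooth psi X).

Lemma vpushE (psi : diffeo) (X : vfield M) p :
  vpush psi X (psi p) = tangent_push erefl (X p).
Proof. by apply: tangent_ext => f /=; rewrite dmapK. Qed.

Fact bilin_pull_linearl (psi : diffeo) (g : bilin_field M) p (w : tangent p) :
  linear (fun v : tangent p =>
    g (psi p) (tangent_push erefl v) (tangent_push erefl w)).
Proof. by move=> a u v; rewrite tangent_push_linear bilin_linearl. Qed.

Fact bilin_pull_linearr (psi : diffeo) (g : bilin_field M) p (v : tangent p) :
  linear (fun w : tangent p =>
    g (psi p) (tangent_push erefl v) (tangent_push erefl w)).
Proof. by move=> a u w; rewrite tangent_push_linear bilin_linearr. Qed.

Fact bilin_pull_smooth (psi : diffeo) (g : bilin_field M) (X Y : vfield M) :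
  smooth_fun (fun p =>
    g (psi p) (tangent_push erefl (X p)) (tangent_push erefl (Y p))).
Proof.
rewrite [Z in @smooth_fun _ _ M Z](_ : _ = bapp g (vpush psi X) (vpush psi Y) \o psi).
  exact: smooth_fun_comp (dmap_smooth psi) (Cinf_smooth _).
by apply/funext => p; rewrite -!vpushE.
Qed.

Definition bilin_pull (psi : diffeo) (g : bilin_field M) : bilin_field M :=
  MkBilin (bilin_pull_linearl psi g) (bilin_pull_linearr psi g)
    (bilin_pull_smooth psi g).

Definition endo_push_fun (psi : diffeo) (F : endo_field M) (q : M)
    (v : tangent q) : tangent q :=
  tangent_push (dinvK psi q)
    (F ((psi^-1)%g q) (tangent_push (psi := (psi^-1)%g) erefl v)).

Fact endo_push_linear (psi : diffeo) (F : endo_field M) q :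
  linear (@endo_push_fun psi F q).
Proof.
by move=> a v w; rewrite /endo_push_fun tangent_push_linear endo_linear
  tangent_push_linear.
Qed.

Fact endo_push_smooth (psi : diffeo) (F : endo_field M)
    (X : vfield M) (f : Cinf M) :
  smooth_fun (fun q => endo_push_fun psi F (X q) f).
Proof.
rewrite [Z in @smooth_fun _ _ M Z](_ : _ =
    vact (eapp F (vpush (psi^-1)%g X)) (pullback psi f) \o dinv psi).
  exact: smooth_fun_comp (dinv_smooth psi) (Cinf_smooth _).
by apply/funext => q; rewrite /endo_push_fun -vpushE.
Qed.

Definition endo_push (psi : diffeo) (F : endo_field M) : endo_field M :=
  MkEndo (endo_push_linear psi F) (endo_push_smooth psi F).

Definition connection_push (psi : diffeo) (nabla : operator M) : operator M :=
  fun X Y => vpush psi (nabla (vpush (psi^-1)%g X) (vpush (psi^-1)%g Y)).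

(* [bilin_pull psi g] is [psi^* g]. *)
Definition diffeo_act (psi : diffeo) (gF : bilin_field M * endo_field M) :=
  (bilin_pull (psi^-1)%g gF.1, endo_push psi gF.2).

Lemma eapp_endo_push (psi : diffeo) (F : endo_field M) X :
  eapp (endo_push psi F) X = vpush psi (eapp F (vpush (psi^-1)%g X)).
Proof.
apply: vfield_ext => q f; rewrite /= /endo_push_fun -vpushE.
by [].
Qed.

Lemma bapp_bilin_pull (psi : diffeo) (g : bilin_field M) X Y :
  bapp (bilin_pull psi g) X Y = pullback psi (bapp g (vpush psi X) (vpush psi Y)).
Proof. by apply/val_inj/funext => p /=; rewrite -!vpushE. Qed.

End Diffeo.

Definition left_action_on (G : groupType) (T : Type) (S : set T)
    (act : G -> T -> T) :=
  [/\ forall x s, S s -> S (act x s),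
      forall s, S s -> act 1%g s = s &
      forall x y s, S s -> act (x * y)%g s = act x (act y s)].

(* Main.v *)
Require Import Defs.
From HB Require Import structures.
From mathcomp Require Import all_boot all_order all_algebra.
From mathcomp Require Import all_classical all_reals topology normedtype landau derive.
From mathcomp Require Import interval_inference sequences exp.
From mathcomp Require Import ring lra.

Set Implicit Arguments.
Unset Strict Implicit.
Unset Printing Implicit Defensive.

Import Order.TTheory GRing.Theory Num.Theory.
Import numFieldNormedType.Exports.

Local Open Scope classical_set_scope.
Local Open Scope ring_scope.

(** Every ingredient of a para-Kaehler structure is natural: functions, tangent
    vectors, vector fields, brackets, metrics and endomorphism fields are all
    carried along a diffeomorphism, and each defining identity of the pushed
    structure is the push-forward of the same identity for the original one.
    Since vector fields of the form [vpush psi X] are all the vector fields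
    ([vpush_ind]), such identities need only be checked on them, where pushed
    operators compute ([connection_pushE], [bapp_push], [eapp_push]).  In this
    way the push-forward of a Levi-Civita connection of [g] is torsion-free and
    metric for the pushed metric ([is_levi_civita_push]).

    To conclude that it is _the_ Levi-Civita connection one needs uniqueness
    ([levi_civita_unique]): the difference [T] of two Levi-Civita connections,
    contracted with the metric, is symmetric in its first two arguments
    (no torsion) and antisymmetric in its last two (metric), hence zero.  This
    gives [g (W, Z) = 0] for every vector field [Z], where [W] is a value of the
    difference, and [W = 0] follows if there are enough global vector fields.
    This is the only analytic point.  Let [m] be the dimension of the manifold
    and [p] a point of a chart.  A bump function times the coordinate fields,
    extended by zero, gives [m] global vector fields, and a bump function times
    the coordinates gives [m] global functions dual to them at [p]
    ([exists_dual_frame]).  As the signature says that the tangent space has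
    dimension [m], these vectors span it ([signature_nondegenerate]).

    The operator [levi_civita g] is defined by choice, with default value zero.
    If no operator qualifies for [g], then none does for the pushed metric, and
    the two default values correspond under push-forward ([levi_civita_push]). *)

(** * A smooth function flat at the origin *)

Lemma is_derive_comp_real (R : realType) (V : normedModType R) (l : V -> R)
    (f : R -> R) (df : R) (x v : V) :
  differentiable l x -> is_derive (l x) 1 f df ->
  is_derive x v (f \o l) (df * 'D_v l x).
Proof.
move=> dl [/derivable1_diffP dfx <-].
have dc : differentiable (f \o l) x by exact: differentiable_comp.
apply: DeriveDef; first exact: diff_derivable.
rewrite (deriveE _ dc) diff_comp //= -(deriveE _ dl) (deriveE _ dfx).
by move: ('D_v l x) => a; rewrite -{1}[a]mulr1 [LHS]linearZ mulrC.
Qed.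

Section FlatExponential.
Context {R : realType}.

(** The family [t^(-k) exp (-1/t)], extended by zero to [t <= 0]: unlike the
    function for [k = 0] alone, it is stable under differentiation up to linear
    combinations, which makes smoothness a plain induction. *)
Definition flat_exp (k : nat) (t : R) : R :=
  if 0 < t then t^-1 ^+ k * expR (- t^-1) else 0.

(** From [exp u >= u^(k+1) / (k+1)!] at [u = 1/t].  It gives continuity at the
    origin for every [k] at once. *)
Lemma flat_exp_bound k (t : R) : `|flat_exp k t| <= k.+1`!%:R * `|t|.
Proof.
rewrite /flat_exp; case: ifPn => [t0|_]; last by rewrite normr0 mulr_ge0.
have s0 : 0 < t^-1 by rewrite invr_gt0.
rewrite !gtr0_norm ?mulr_gt0 ?exprn_gt0 ?expR_gt0 // expRN.
rewrite ler_pdivrMr ?expR_gt0 //.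
have := expR_ge1Dxn k (ltW s0) => h.
have {}h : t^-1 ^+ k.+1 / k.+1`!%:R <= expR t^-1.
  by apply: le_trans h; rewrite lerDr.
rewrite ler_pdivrMr ?ltr0n ?fact_gt0 // in h.
rewrite -(ler_pM2l s0) -exprS (le_trans h) //.
have tn0 : t != 0 by rewrite gt_eqF.
by move: (expR _) (_%:R) => e a; rewrite [leRHS](_ : _ = e * a) //; field.
Qed.

(** At the origin the difference quotient of [flat_exp k] is [flat_exp k.+1],
    which tends to [0] by [flat_exp_bound]. *)
Lemma is_derive_flat_exp k (t : R) :
  is_derive t 1 (flat_exp k) (flat_exp k.+2 t - k%:R * flat_exp k.+1 t).
Proof.
have [t0|t0|->] := ltgtP t 0.
- rewrite /flat_exp ltNge (ltW t0) /= mulr0 subr0.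
  apply: (near_eq_is_derive (f := cst 0)).
  near=> s; rewrite ltNge (_ : s <= 0) // ltW //; near: s.
  exact: lt_nbhsl.
- have tn0 : t != 0 by rewrite gt_eqF.
  rewrite /flat_exp t0.
  pose phi (s : R) := s ^+ k * expR (- s).
  apply: (near_eq_is_derive (f := phi \o (fun s => s^-1))).
    near=> s; rewrite /phi /= ifT //; near: s; exact: lt_nbhsr.
  have dphi (s : R) : is_derive s 1 phi
      (k%:R * s ^+ k.-1 * expR (- s) - s ^+ k * expR (- s)).
    have dN : is_derive s (1 : R) (expR \o -%R) (expR (- s) * 'D_1 -%R s).
      by apply: is_derive_comp_real; exact/derivable1_diffP/derivable_opp.
    have := is_deriveM (is_deriveX k (is_derive_id s (1:R))) dN.
    rewrite (@derive_val _ _ _ _ _ _ _ (is_deriveNid s (1 : R))).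
    have -> : phi = (@id R) ^+ k * (expR \o -%R).
      by apply/funext => u; rewrite /phi fctE exprfctE.
    move=> /is_derive_eq; apply.
    rewrite exprfctE.
    by rewrite /GRing.scale /=; ring.
  have dI : differentiable (fun s : R => s^-1) t.
    by apply/derivable1_diffP/derivableV.
  have /is_derive_eq := is_derive_comp_real (1 : R) dI (dphi t^-1); apply.
  rewrite deriveV // derive_id /GRing.scale /= -exprVn.
  move: (expR _) => e; move: (t^-1) => s.
  case: k {phi dphi} => [|k] /=; first by ring.
  by rewrite !exprS; ring.
- have f0 k' : flat_exp k' @ 0^' --> (0 : R).
    apply/cvgr0Pnorm_lt => e e0.
    have C0 : 0 < (k'.+1`!%:R : R) by rewrite ltr0n fact_gt0.
    near=> h; apply: le_lt_trans (flat_exp_bound _ _) _.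
    rewrite mulrC -ltr_pdivlMr //; near: h.
    by apply: dnbhs0_lt; rewrite divr_gt0.
  pose q h := h^-1 *: ((flat_exp k \o shift 0) (h *: 1) - flat_exp k 0).
  have qE h : q h = flat_exp k.+1 h.
    rewrite /q /flat_exp /= ltxx subr0 addr0 [h *: 1]mulr1; case: ifP => h0.
      by rewrite exprS -mulrA.
    by rewrite scaler0.
  have cv : q @ 0^' --> (0 : R).
    by rewrite (_ : q = flat_exp k.+1); [exact: f0 | exact/funext].
  rewrite {2 3}/flat_exp ltxx mulr0 subr0.
  by apply: DeriveDef; [exact: cvgP cv | exact: cvg_lim cv].
Unshelve. all: by end_near.
Qed.

Lemma class_C_flat_exp j k m (U : set 'rV[R]_m) (l : 'rV[R]_m -> R) :
  open U -> smooth_on U l -> class_C j U (flat_exp k \o l).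
Proof.
move=> oU sl; have dl x : U x -> differentiable l x by have [+ _] := sl 1; exact.
have df k' x : U x -> differentiable (flat_exp k' \o l) x.
  move=> Ux; apply: differentiable_comp (dl x Ux) _.
  by have [/derivable1_diffP] := is_derive_flat_exp k' (l x).
elim: j k => [|j IH] k.
  by move=> x Ux; exact: differentiable_continuous (df k x Ux).
split=> [|i]; first exact: df.
have H : class_C j U (((flat_exp k.+2 \o l) \+
    (cst (- k%:R) \* (flat_exp k.+1 \o l))) \* 'D_('e_i) l).
  apply: class_C_mul => //; last by have [_ +] := sl j.+1; exact.
  apply: class_C_add => //; apply: class_C_mul => //; exact: class_C_cst.
apply: class_C_ext oU _ H => x Ux /=.
have := is_derive_comp_real 'e_i (dl x Ux) (is_derive_flat_exp k (l x)).
by move=> [_ ->]; rewrite mulNr.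
Qed.

End FlatExponential.

(** * Bump functions and extension by zero *)

Section Bump.
Context {R : realType} {m : nat}.
Implicit Types (U : set 'rV[R]_m) (x y : 'rV[R]_m).

Lemma derive_coordE (v x : 'rV[R]_m) (j : 'I_m) :
  'D_v (fun y : 'rV[R]_m => y 0 j) x = v 0 j.
Proof.
rewrite (derive_coord (h := id)) ?derive_id //; exact: differentiable_id.
Qed.

Lemma smooth_coord U (j : 'I_m) : smooth_on U (fun x => x 0 j).
Proof.
case=> [|k]; first by move=> x _; exact: coord_continuous.
split=> [x _|i]; first exact: differentiable_coord.
rewrite [X in class_C _ _ X](_ : _ = cst ((@delta_mx R 1 m 0 i) 0 j)).
  exact: class_C_cst.
by apply/funext => x; rewrite derive_coordE.
Qed.

Lemma smooth_coord_sub U (a : R) (j : 'I_m) : open U ->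
  smooth_on U (fun x => x 0 j - a).
Proof.
move=> oU k; apply: class_C_add oU _ _; first exact: smooth_coord.
exact: class_C_cst.
Qed.

(** The function is [flat_exp 0 (r^2 - d^2)] normalised at [x], where [d] is the
    Euclidean distance to [x], so that the argument is smooth; its support lies
    in the sup-norm ball of radius [r], which is the ball of the topology. *)
Lemma exists_bump U x : open U -> U x ->
  exists (chi : 'rV[R]_m -> R) (K : set 'rV[R]_m),
    [/\ smooth_on U chi, chi x = 1, compact K, K `<=` U &
        forall y, ~ K y -> chi y = 0].
Proof.
move=> oU Ux.
have /nbhs_closedballP [r rU] := open_nbhs_nbhs (conj oU Ux).
pose l y : R := r%:num ^+ 2 + (-1) * \sum_i (y 0 i - x 0 i) * (y 0 i - x 0 i).
have sl : smooth_on U l.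
  move=> k; apply: class_C_add => //; first exact: class_C_cst.
  apply: class_C_mul => //; first exact: class_C_cst.
  by apply: class_C_sum => // i; apply: class_C_mul => //; exact: smooth_coord_sub.
have lx : l x = r%:num ^+ 2.
  by rewrite /l big1 ?mulr0 ?addr0 // => i _; rewrite subrr mul0r.
pose e := flat_exp 0 (l x).
have e0 : e != 0.
  by rewrite /e /flat_exp lx exprn_gt0 // expr0 mul1r gt_eqF // expR_gt0.
exists (fun y => e^-1 * flat_exp 0 (l y)), (closed_ball x r%:num); split => //.
- move=> k; apply: class_C_mul => //; first exact: class_C_cst.
  exact: class_C_flat_exp.
- by rewrite mulVf.
- apply: bounded_closed_compact; last exact: closed_ball_closed.
  exists (`|x| + r%:num); split=> [|b xb y]; first exact: num_real.
  rewrite closed_ballE //= /closed_ball_ /= => xy; apply: le_trans (ltW xb).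
  rewrite -[y](subKr x); apply: le_trans (ler_normB _ _) _.
  by rewrite lerD2l.
- move=> y Ky; rewrite /flat_exp ifF ?mulr0 //.
  apply/negbTE; rewrite -leNgt /l mulN1r subr_le0.
  rewrite leNgt; apply/negP => lt; apply: Ky.
  rewrite closed_ballE // /closed_ball_ /=.
  rewrite /Num.Def.normr /= mx_normrE; apply: bigmax_le => // -[a j] _ /=.
  rewrite !ord1 !mxE distrC -ler_sqr ?nnegrE // real_normK ?num_real //.
  apply: le_trans (ltW lt).
  by rewrite (bigD1 j) //= lerDl sumr_ge0 // => i _; exact: sqr_ge0.
Qed.

End Bump.

Section ChartExtension.
Context {R : realType} {m : nat} (M : manifold R m) (c : chart R m M).
Context (ac : atlas c).

Definition chart_ext (phi : 'rV[R]_m -> R) (q : M) : R :=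
  if q \in cdom c then phi (cmap c q) else 0.

Lemma chart_extE phi q : cdom c q -> chart_ext phi q = phi (cmap c q).
Proof. by move=> cq; rewrite /chart_ext mem_set. Qed.

(** The preimage of the compact set [K] is closed because [M] is Hausdorff; thus
    [M] is covered by the open sets [cdom c], where the extension is [phi] in a
    chart, and the complement of that preimage, where it is zero. *)
Lemma chart_ext_smooth (K : set 'rV[R]_m) phi :
  compact K -> K `<=` cmap c @` cdom c -> (forall x, ~ K x -> phi x = 0) ->
  smooth_on (cmap c @` cdom c) phi -> smooth_fun (chart_ext phi).
Proof.
move=> cK KU phi0 sphi.
have oK : open (~` (cinv c @` K)).
  rewrite openC; apply: compact_closed; first exact: mhausdorff.
  apply: continuous_compact cK; apply: continuous_in_subspaceT => x /set_mem Kx.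
  by apply: cinv_continuous; exact: KU.
move=> d ad k; apply: class_C_loc => _ [p dp <-].
have [cp|ncp] := pselect (cdom c p).
  exists (cmap d @` (cdom d `&` cdom c)); first by exists p.
  have oU : open (cmap d @` (cdom d `&` cdom c)).
    by apply: cmap_img_open; exact: cdom_open.
  have UV x : (cmap d @` (cdom d `&` cdom c)) x ->
      (cmap c @` cdom c) ((cmap c \o cinv d) x).
    by move=> [q [dq cq] <-] /=; rewrite cmapK ?inE //; exists q.
  have := class_C_comp oU UV (atlas_compat ad ac) (sphi k).
  apply: class_C_ext oU _ => _ [q [dq cq] <-] /=.
  by rewrite cmapK ?inE // chart_extE.
exists (cmap d @` (cdom d `&` ~` (cinv c @` K))).
  exists p => //; split=> // -[x Kx xp]; apply: ncp; rewrite -xp.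
  by have [q cq <-] := KU _ Kx; rewrite cmapK ?inE.
apply: class_C_ext (class_C_cst k _ 0); first exact: cmap_img_open.
move=> _ [q [dq Kq] <-] /=; rewrite cmapK ?inE // /chart_ext.
case: ifPn => // /set_mem cq; rewrite phi0 // => Kcq; apply: Kq.
by exists (cmap c q) => //; rewrite cmapK ?inE.
Qed.

Lemma Cinf_differentiable (f : Cinf M) q : cdom c q ->
  differentiable (f \o cinv c) (cmap c q).
Proof. by move=> cq; have [+ _] := Cinf_smooth f ac 1; apply; exists q. Qed.

Section BumpField.
Context (chi : 'rV[R]_m -> R) (i : 'I_m).

Fact bump_derivation (q : M) : derivation_at q (fun f : Cinf M =>
  chart_ext (fun x => chi x * 'D_('e_i) (f \o cinv c) x) q).
Proof.
rewrite /chart_ext; case: (boolP (q \in cdom c)) => [/set_mem cq|_]; last first.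
  by split=> [a f g|f g]; rewrite ?scaler0 ?addr0 // mul0r mulr0 addr0.
have D f := diff_derivable (v := 'e_i) (Cinf_differentiable f cq).
split=> [a f g|f g].
  have -> : (a *: f + g) \o cinv c = a *: (f \o cinv c) + (g \o cinv c) by [].
  rewrite (deriveD (derivableZ (D f)) (D g)) deriveZ //.
  by rewrite mulrDr /GRing.scale /= mulrCA.
have -> : (f * g) \o cinv c = (f \o cinv c : _ -> R) * (g \o cinv c) by [].
rewrite (deriveM (D f) (D g)) /GRing.scale /= cmapK ?inE //; ring.
Qed.

Fact bump_smooth (K : set 'rV[R]_m) (f : Cinf M) :
  compact K -> K `<=` cmap c @` cdom c -> (forall x, ~ K x -> chi x = 0) ->
  smooth_on (cmap c @` cdom c) chi ->
  smooth_fun (fun q => mkTangent (bump_derivation q) f).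
Proof.
move=> cK KU chi0 schi.
apply: (chart_ext_smooth (phi := fun x => chi x * 'D_('e_i) (f \o cinv c) x) cK KU).
  by move=> x /chi0 ->; rewrite mul0r.
move=> k; apply: class_C_mul => //; first exact: cimg_open.
by have [_ +] := Cinf_smooth f ac k.+1; exact.
Qed.

End BumpField.
End ChartExtension.

(** With [chi] a bump function at [x = cmap c p], take [chi *: d/dx_i] and
    [chi * (x_j - x_j(p))].  Since [chi x = 1] and [x_j - x_j(p)] vanishes at
    [p], the derivatives of [chi] do not contribute at [p]. *)
Lemma exists_dual_frame (R : realType) m (M : manifold R m) (p : M) :
  exists (Z : 'I_m -> vfield M) (f : 'I_m -> Cinf M),
    forall i j, Z i p (f j) = (i == j)%:R.
Proof.
have [c ac cp] := atlas_cover p.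
have oU := cimg_open c.
have Ux : (cmap c @` cdom c) (cmap c p) by exists p.
have [chi [K [schi chi1 cK KU chi0]]] := exists_bump oU Ux.
set x := cmap c p in Ux chi1.
pose Z i := MkVfield (fun f => bump_smooth ac i f cK KU chi0 schi).
pose psi j (y : 'rV[R]_m) := chi y * (y 0 j - x 0 j).
have spsi j : smooth_fun (chart_ext c (psi j)).
  apply: (chart_ext_smooth ac cK KU) => [y /chi0 h|k].
    by rewrite /psi h mul0r.
  by apply: class_C_mul => //; exact: smooth_coord_sub.
exists Z, (fun j => mkCinf (spsi j)) => i j /=.
rewrite chart_extE // -/x chi1 mul1r.
have nE : \near x, psi j x = (chart_ext c (psi j) \o cinv c) x.
  apply: filterS (open_nbhs_nbhs (conj oU Ux)) => _ [q cq <-] /=.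
  by rewrite cmapK ?inE // chart_extE.
rewrite -(near_eq_derive _ nE).
have [dchi _] := schi 1.
have [dcoord _] := smooth_coord_sub (x 0 j) j oU 1.
rewrite (deriveM (diff_derivable (dchi _ Ux)) (diff_derivable (dcoord _ Ux))).
rewrite chi1 subrr scale0r addr0 scale1r.
have dcoordj := diff_derivable (differentiable_coord x 0 j).
rewrite (deriveB (dcoordj _) (derivable_cst _ _ _)).
by rewrite derive_coordE derive_cst subr0 mxE eqxx /= eq_sym.
Qed.

(** * Nondegeneracy and uniqueness of the Levi-Civita connection *)

Lemma linear_sumZ (R : pzRingType) (V W : lmodType R) (h : V -> W) (I : finType)
    (a : I -> R) (v : I -> V) :
  linear h -> h (\sum_i a i *: v i) = \sum_i a i *: h (v i).
Proof.
move=> lh.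
pose L : {linear V -> W} := HB.pack h (GRing.isLinear.Build _ _ _ _ h lh).
by rewrite -[h]/(L : V -> W) linear_sum; under eq_bigr do rewrite linearZ.
Qed.

Lemma is_basis_transport (R : realType) (V W : lmodType R) (S : set V) (T : set W)
    (h : V -> W) (h' : W -> V) k (e : 'I_k -> V) :
  linear h -> cancel h h' -> cancel h' h ->
  (forall v, S v -> T (h v)) -> (forall w, T w -> S (h' w)) ->
  is_basis S e -> is_basis T (h \o e).
Proof.
move=> lh hK h'K ST TS [Se free span]; split=> [i|a|w Tw]; first exact/ST/Se.
  rewrite -linear_sumZ // => h0; apply: free; apply: (can_inj hK); rewrite h0.
  by have := lh (-1) 0 0; rewrite scaler0 addr0 scaleN1r addNr.
have [a ha] := span _ (TS _ Tw); exists a.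
by rewrite -[LHS]h'K ha linear_sumZ.
Qed.

Section Nondegeneracy.
Context {R : realType} {m : nat} (M : manifold R m).
Implicit Types (g : bilin_field M) (W X Y Z : vfield M).

Lemma tangent_eval_linear p (f : Cinf M) : linear (fun v : tangent p => v f : R^o).
Proof. by []. Qed.

(** The signature provides a basis of [r + s = m] vectors, so the [m] vectors
    [Z i p] of [exists_dual_frame], independent since they have a dual family of
    functions, span the tangent space; a vector orthogonal to them is orthogonal
    to the basis, hence zero. *)
Lemma signature_nondegenerate g r s p (w : tangent p) :
  (r + s)%N = m -> has_signature g r s p ->
  (forall Z, g p w (Z p) = 0) -> w = 0.
Proof.
move=> rs [e [[_ _ span] ge]] gw.
have [Z [f Zf]] := exists_dual_frame p.
have /choice [a Za] := fun i => span (Z i p) I.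
(* Duality with [f] is a right inverse of [A], and [A] is square up to [rs]. *)
pose A : 'M[R]_(m, r + s) := \matrix_(i, k) a i k.
have rA : row_full A.
  have : row_free A.
    apply/row_freeP; exists (\matrix_(k, j) e k (f j)); apply/matrixP => i j.
    rewrite !mxE -Zf Za (linear_sumZ _ _ (tangent_eval_linear (f j))).
    by apply: eq_bigr => k _; rewrite !mxE.
  by rewrite /row_free /row_full => /eqP ->; rewrite rs.
have ew k : g p w (e k) = 0.
  have /row_fullP [B BA] := rA.
  pose u := \col_l (g p w (e l) : R).
  suff u0 : u = 0.
    by have := congr1 (fun v : 'cV[R]_(r + s) => v k 0) u0; rewrite !mxE.
  rewrite -[u]mul1mx -BA -mulmxA (_ : A *m u = 0) ?mulmx0 //.
  apply/colP => i; have := gw (Z i).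
  rewrite Za (linear_sumZ _ _ (bilin_linearr g w)).
  by move=> s0; rewrite [RHS]mxE -[RHS]s0 mxE; apply: eq_bigr => l _; rewrite !mxE.
have [b wb] := span w I.
rewrite wb big1 // => k _; suff -> : b k = 0 by rewrite scale0r.
have := ew k; rewrite wb (linear_sumZ _ _ (bilin_linearl g (e k))).
rewrite (bigD1 k) //= big1 => [|l lk]; last by rewrite ge (negPf lk) scaler0.
rewrite ge eqxx addr0 => /eqP; rewrite mulf_eq0 => /orP [/eqP //|].
by case: ifP => _; rewrite ?oppr_eq0 oner_eq0.
Qed.

Lemma bappBl g X Y Z : bapp g (X - Y) Z = bapp g X Z - bapp g Y Z.
Proof.
apply/val_inj/funext => p /=; rewrite addrC -scaleN1r.
by rewrite (bilin_linearl g (Z p)) scaleN1r addrC.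
Qed.

Lemma neutral_nondegenerate n g W : (n + n)%N = m ->
  neutral_metric n g -> (forall Z, bapp g W Z = 0) -> W = 0.
Proof.
move=> nm [_ sg] gW; apply: vfield_ext => p f.
rewrite (signature_nondegenerate nm (sg p) (w := W p)) // => Z.
by have := congr1 (fun h : Cinf M => h p) (gW Z).
Qed.

(** The tensor [T] below is symmetric in its first two arguments and
    antisymmetric in its last two; alternating the two symmetries six times
    returns to the same arguments with the opposite sign, so [T] vanishes. *)
Lemma levi_civita_unique n g (D E : operator M) : (n + n)%N = m ->
  neutral_metric n g -> is_levi_civita g D -> is_levi_civita g E -> D = E.
Proof.
move=> nm ng [_ tD mD] [_ tE mE]; have [sg _] := ng.
have symg X Y : bapp g X Y = bapp g Y X by apply/val_inj/funext => p /=.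
pose T X Y Z := bapp g (D X Y - E X Y) Z.
have Tskew X Y Z : T X Y Z = - T X Z Y.
  apply/eqP; rewrite -addr_eq0 /T !bappBl.
  by rewrite addrACA -opprD (symg _ Y) -mD (symg _ Y) -mE subrr.
have Tsym X Y Z : T X Y Z = T Y X Z.
  have tor (N : operator M) : (forall X Y, torsion N X Y = 0) ->
      N X Y = lie X Y + N Y X.
    by move=> tN; have /subr0_eq <- := tN X Y; rewrite subrK.
  rewrite /T (tor _ tD) (tor _ tE); congr bapp.
  by rewrite opprD addrACA subrr add0r.
have T0 X Y Z : T X Y Z = 0.
  have : T X Y Z = - T X Y Z.
    by rewrite {1}Tskew Tsym Tskew opprK Tsym Tskew Tsym.
  move=> /eqP; rewrite -addr_eq0 => /eqP TT; apply/val_inj/funext => p.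
  have {}TT : (T X Y Z p : R) + T X Y Z p = 0 := congr1 (fun h : Cinf M => h p) TT.
  by rewrite -[LHS]/(T X Y Z p : R) -[RHS]/(0 : R); lra.
apply/funext => X; apply/funext => Y; apply/subr0_eq.
by apply: neutral_nondegenerate nm ng _ => Z; exact: T0.
Qed.

End Nondegeneracy.

(** * Naturality under diffeomorphisms *)

Section Naturality.
Context {R : realType} {m : nat} (M : manifold R m).
Implicit Types (psi phi : diffeo M) (f k : Cinf M) (X Y Z : vfield M).
Implicit Types (g h : bilin_field M) (F G : endo_field M) (D : operator M).

Lemma bilin_ext g h : (forall p (v w : tangent p), g p v w = h p v w) -> g = h.
Proof.
case: g h => [b b1 b2 b3] [c c1 c2 c3] /= bc.
have E : b = c.
  apply: functional_extensionality_dep => p.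
  by apply/funext => v; apply/funext => w; exact: bc.
by subst c; congr MkBilin; exact: Prop_irrelevance.
Qed.

Lemma endo_ext F G : (forall p (v : tangent p), F p v = G p v) -> F = G.
Proof.
case: F G => [A A1 A2] [B B1 B2] /= AB.
have E : A = B.
  by apply: functional_extensionality_dep => p; apply/funext => v; exact: AB.
by subst B; congr MkEndo; exact: Prop_irrelevance.
Qed.

Lemma tangent_pushK psi p q (e : psi p = q) (e' : (psi^-1)%g q = p) :
  cancel (tangent_push e) (tangent_push e').
Proof.
move=> v; apply: tangent_ext => f /=; congr (v _); apply/val_inj/funext => x /=.
by rewrite dmapK.
Qed.

(** Not an instance of [tangent_pushK]: [(psi^-1)^-1] is equal to [psi] only
    propositionally. *)
Lemma tangent_pushVK psi p q (e : (psi^-1)%g q = p) (e' : psi p = q) :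
  cancel (tangent_push e) (tangent_push e').
Proof.
move=> v; apply: tangent_ext => f /=; congr (v _); apply/val_inj/funext => x /=.
by rewrite dinvK.
Qed.

Lemma pullbackK psi : cancel (pullback psi) (pullback (psi^-1)%g).
Proof. by move=> f; apply/val_inj/funext => x /=; rewrite dinvK. Qed.

Lemma pullbackVK psi : cancel (pullback (psi^-1)%g) (pullback psi).
Proof. by move=> f; apply/val_inj/funext => x /=; rewrite dmapK. Qed.

Lemma vact_vpush psi X f :
  vact (vpush psi X) f = pullback (psi^-1)%g (vact X (pullback psi f)).
Proof. by apply/val_inj/funext. Qed.

Lemma vact_inj X Y : (forall f, vact X f = vact Y f) -> X = Y.
Proof.
move=> XY; apply: vfield_ext => p f.
by have := congr1 (fun h : Cinf M => h p) (XY f).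
Qed.

Lemma vpushK psi : cancel (vpush psi) (vpush (psi^-1)%g).
Proof.
move=> X; apply: vact_inj => f.
by rewrite !vact_vpush invgK !(pullbackVK, pullbackK).
Qed.

Lemma vpushVK psi : cancel (vpush (psi^-1)%g) (vpush psi).
Proof. by move=> X; rewrite -{1}[psi]invgK vpushK. Qed.

Lemma vpushD psi X Y : vpush psi (X + Y) = vpush psi X + vpush psi Y.
Proof. by apply: vfield_ext. Qed.

Lemma vpushN psi X : vpush psi (- X) = - vpush psi X.
Proof. by apply: vfield_ext. Qed.

Lemma vpush0 psi : vpush psi 0 = 0.
Proof. by apply: vfield_ext. Qed.

Lemma vpushZ psi f X : vpush psi (f *: X) = pullback (psi^-1)%g f *: vpush psi X.
Proof. by apply: vfield_ext. Qed.

Lemma pullbackD psi f k : pullback psi (f + k) = pullback psi f + pullback psi k.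
Proof. by apply/val_inj/funext. Qed.

Lemma pullbackN psi f : pullback psi (- f) = - pullback psi f.
Proof. by apply/val_inj/funext. Qed.

Lemma vpush_lie psi X Y : vpush psi (lie X Y) = lie (vpush psi X) (vpush psi Y).
Proof.
have lieE A B f : vact (lie A B) f = vact A (vact B f) - vact B (vact A f).
  exact/val_inj/funext.
apply: vact_inj => f; rewrite vact_vpush !lieE !vact_vpush !pullbackVK.
by rewrite pullbackD pullbackN.
Qed.

(** The working principle for the identities below: after it, every vector field
    in sight is a push-forward, and pushed operators reduce to the original ones
    by the equations that follow. *)
Lemma vpush_ind psi (P : vfield M -> Prop) :
  (forall X, P (vpush psi X)) -> forall X, P X.
Proof. by move=> PX X; rewrite -(vpushVK psi X). Qed.

Lemma connection_pushE psi D X Y :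
  connection_push psi D (vpush psi X) (vpush psi Y) = vpush psi (D X Y).
Proof. by rewrite /connection_push !vpushK. Qed.

Lemma bapp_push psi g X Y :
  bapp (bilin_pull (psi^-1)%g g) (vpush psi X) (vpush psi Y)
    = pullback (psi^-1)%g (bapp g X Y).
Proof. by rewrite bapp_bilin_pull !vpushK. Qed.

Lemma eapp_push psi F X :
  eapp (endo_push psi F) (vpush psi X) = vpush psi (eapp F X).
Proof. by rewrite eapp_endo_push vpushK. Qed.

Lemma vact_push psi X f :
  vact (vpush psi X) (pullback (psi^-1)%g f) = pullback (psi^-1)%g (vact X f).
Proof. by rewrite vact_vpush pullbackVK. Qed.

Lemma is_levi_civita_push psi g D : is_levi_civita g D ->
  is_levi_civita (bilin_pull (psi^-1)%g g) (connection_push psi D).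
Proof.
move=> [[Dl Dr DZ] tD mD]; split; first split.
- move=> f; rewrite -(pullbackK psi f); move: (pullback psi f) => {}f.
  apply: (vpush_ind (psi := psi)) => X; apply: (vpush_ind (psi := psi)) => X'.
  apply: (vpush_ind (psi := psi)) => Y.
  by rewrite -vpushZ -vpushD !connection_pushE Dl vpushD vpushZ.
- apply: (vpush_ind (psi := psi)) => X; apply: (vpush_ind (psi := psi)) => Y.
  apply: (vpush_ind (psi := psi)) => Y'.
  by rewrite -vpushD !connection_pushE Dr vpushD.
- move=> f; rewrite -(pullbackK psi f); move: (pullback psi f) => {}f.
  apply: (vpush_ind (psi := psi)) => X; apply: (vpush_ind (psi := psi)) => Y.
  by rewrite -vpushZ !connection_pushE DZ vpushD !vpushZ vact_push.
- apply: (vpush_ind (psi := psi)) => X; apply: (vpush_ind (psi := psi)) => Y.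
  rewrite /torsion !connection_pushE -vpush_lie -!vpushN -!vpushD.
  by rewrite -[X in vpush psi X]/(torsion D X Y) tD vpush0.
- apply: (vpush_ind (psi := psi)) => X; apply: (vpush_ind (psi := psi)) => Y.
  apply: (vpush_ind (psi := psi)) => Z.
  by rewrite !connection_pushE !bapp_push vact_push mD pullbackD.
Qed.

Lemma flat_push psi D : flat D -> flat (connection_push psi D).
Proof.
move=> fD; apply: (vpush_ind (psi := psi)) => X.
apply: (vpush_ind (psi := psi)) => Y; apply: (vpush_ind (psi := psi)) => Z.
rewrite /curvature -vpush_lie !connection_pushE -!vpushN -!vpushD.
by rewrite -[X in vpush psi X]/(curvature D X Y Z) fD vpush0.
Qed.

Lemma nabla_endo_push psi D F X Y :
  nabla_endo (connection_push psi D) (endo_push psi F) (vpush psi X) (vpush psi Y)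
    = vpush psi (nabla_endo D F X Y).
Proof.
by rewrite /nabla_endo eapp_push !connection_pushE eapp_push -vpushN -vpushD.
Qed.

Lemma compatible_push psi g F :
  compatible g F -> compatible (bilin_pull (psi^-1)%g g) (endo_push psi F).
Proof.
move=> gF; apply: (vpush_ind (psi := psi)) => X.
apply: (vpush_ind (psi := psi)) => Y.
by rewrite !eapp_push !bapp_push gF pullbackN.
Qed.

Lemma bilin_pull1 g : bilin_pull 1%g g = g.
Proof.
apply: bilin_ext => p v w /=; congr (g p _ _); apply: tangent_ext => f /=.
  by congr (v _); exact/val_inj/funext.
by congr (w _); exact/val_inj/funext.
Qed.

Lemma bilin_pullM psi phi g :
  bilin_pull (psi * phi)%g g = bilin_pull phi (bilin_pull psi g).
Proof.
apply: bilin_ext => p v w /=; congr (g _ _ _); apply: tangent_ext => f /=.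
  by congr (v _); exact/val_inj/funext.
by congr (w _); exact/val_inj/funext.
Qed.

Lemma endo_push1 F : endo_push 1%g F = F.
Proof.
apply: endo_ext => q v; apply: tangent_ext => f /=.
have -> : pullback 1%g f = f by exact/val_inj/funext.
congr (F q _ f); apply: tangent_ext => k /=; congr (v _); exact/val_inj/funext.
Qed.

Lemma endo_pushM psi phi F :
  endo_push (psi * phi)%g F = endo_push psi (endo_push phi F).
Proof.
apply: endo_ext => q v; apply: tangent_ext => f /=.
have -> : pullback (psi * phi)%g f = pullback phi (pullback psi f).
  exact/val_inj/funext.
congr (F _ _ _); apply: tangent_ext => k /=; congr (v _); exact/val_inj/funext.
Qed.

Lemma neutral_metric_pull psi n g :
  neutral_metric n g -> neutral_metric n (bilin_pull psi g).
Proof.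
move=> [sg ng]; split=> [p v w|p]; first exact: sg.
have [e [be ge]] := ng (psi p).
pose h := @tangent_push _ _ _ (psi^-1)%g _ _ (dmapK psi p).
pose h' := @tangent_push _ _ _ psi p _ erefl.
have hK : cancel h h' by exact: tangent_pushVK.
exists (h \o e); split.
  apply: (is_basis_transport (h' := h')) be => //; first exact: tangent_push_linear.
  exact: tangent_pushK.
by move=> i j; rewrite -ge -[in RHS](hK (e i)) -[in RHS](hK (e j)).
Qed.

Lemma almost_paracomplex_push psi n F :
  almost_paracomplex n F -> almost_paracomplex n (endo_push psi F).
Proof.
move=> [FF dF]; pose h q := @tangent_push _ _ _ psi _ _ (dinvK psi q).
pose h' q := @tangent_push _ _ _ (psi^-1)%g q _ erefl.
have hK q : cancel (h q) (h' q) by exact: tangent_pushK.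
have h'K q : cancel (h' q) (h q) by exact: tangent_pushVK.
have hF q v : endo_push psi F q (h q v) = h q (F _ v).
  by rewrite -[in RHS](hK q v).
split=> [q v|q].
  by rewrite -(h'K q v) !hF FF.
have transport a (e : 'I_n -> tangent ((psi^-1)%g q)) :
    is_basis (eigenspace_at F a (p := (psi^-1)%g q)) e ->
    is_basis (eigenspace_at (endo_push psi F) a (p := q)) (h q \o e).
  apply: (is_basis_transport _ (hK q) (h'K q)).
  - exact: tangent_push_linear.
  - by move=> v Fv; apply: etrans (hF q v) _; rewrite [F _ v]Fv; exact: tangent_ext.
  - move=> w Fw; apply: (can_inj (hK q)); apply: etrans (esym (hF q _)) _.
    rewrite h'K [endo_push _ _ _ w]Fw -{1}(h'K q w); exact: tangent_ext.
have [[e be] [d bd]] := dF ((psi^-1)%g q).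
by split; [exists (h q \o e) | exists (h q \o d)]; exact: transport.
Qed.

End Naturality.

(** * The action on para-Kaehler structures *)

(** If [g] has a Levi-Civita connection this is [is_levi_civita_push] with
    uniqueness for the pushed metric.  Otherwise the pushed metric has none
    either, since [psi^-1] would push it back to one for [g], and both sides are
    zero. *)
Lemma levi_civita_push (R : realType) m (M : manifold R m) (psi : diffeo M) n
    (g : bilin_field M) : (n + n)%N = m -> neutral_metric n g ->
  levi_civita (bilin_pull (psi^-1)%g g) = connection_push psi (levi_civita g).
Proof.
move=> nm ng; have ng' := neutral_metric_pull (psi^-1)%g ng.
have [[D lcD]|noD] := pselect (exists D, is_levi_civita g D).
  apply: (levi_civita_unique nm ng'); last first.
    apply: is_levi_civita_push.
    exact: (@xgetPex _ _ (is_levi_civita g)) (ex_intro _ D lcD).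
  apply: (@xgetPex _ _ (is_levi_civita (bilin_pull psi^-1%g g))).
  by exists (connection_push psi D); exact: is_levi_civita_push.
rewrite /levi_civita !xgetPN => [|D lcD|D lcD].
- by apply/funext => X; apply/funext => Y; rewrite /connection_push vpush0.
- by apply: noD; exists D.
apply: noD; exists (connection_push (psi^-1)%g D).
have := is_levi_civita_push (psi^-1)%g lcD.
by rewrite invgK -bilin_pullM mulVg bilin_pull1.
Qed.

Lemma para_kahler_push (R : realType) m (M : manifold R m) (psi : diffeo M) n gF :
  (n + n)%N = m -> @para_kahler R m M n gF -> para_kahler n (diffeo_act psi gF).
Proof.
case: gF => g F nm [/= ng pF gF nF]; split=> /=.
- exact: neutral_metric_pull.
- exact: almost_paracomplex_push.
- exact: compatible_push.
- rewrite (levi_civita_push psi nm ng).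
  apply: (vpush_ind (psi := psi)) => X; apply: (vpush_ind (psi := psi)) => Y.
  by rewrite nabla_endo_push nF vpush0.
Qed.

Theorem theorem3p1 (R : realType) (n : nat) (n_gt0 : (0 < n)%N)
    (M : manifold R (2 * n)%N) (g0 : bilin_field M) (F0 : endo_field M)
    (gF0_para_kahler : para_kahler n (g0, F0)) :
  [/\ left_action_on (para_kahler n) (@diffeo_act R (2 * n)%N M),
      (forall (psi : diffeo M) (g : bilin_field M) (F : endo_field M),
        para_kahler n (g, F) ->
        levi_civita (bilin_pull (psi^-1)%g g)
          = connection_push psi (levi_civita g)) &
      (forall (psi : diffeo M) (gF : bilin_field M * endo_field M),
        affine_para_kahler n gF -> affine_para_kahler n (diffeo_act psi gF))].
Proof.
have nm : (n + n = 2 * n)%N by rewrite mul2n addnn.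
split; first split.
- by move=> psi gF; exact: para_kahler_push.
- by move=> [g F] _; rewrite /diffeo_act invg1 bilin_pull1 endo_push1.
- by move=> psi phi [g F] _; rewrite /diffeo_act invgM bilin_pullM endo_pushM.
- by move=> psi g F [ng _ _ _]; exact: levi_civita_push nm ng.
move=> psi [g F] [pk fl]; split; first exact: para_kahler_push.
have [ng _ _ _] := pk.
by rewrite /= (levi_civita_push psi nm ng); exact: flat_push.
Qed.
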